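(* (First and second mean value theorem for integrals) Suppose $g\in\mathcal{HKBV}(\overline{\mathbb R}^2)$ is such that $g(a,c)+g(b,d)-g(a,d)-g(b,c)\ge0$ for all $[a,b]\times[c,d]\subseteq\overline{\mathbb R}^2$. (a) Suppose $F\in C(\overline{\mathbb R}^2)$. Then there exists $(\xi,\eta)\in\overline{\mathbb R}^2$ such that $$\int_{-\infty}^\infty\int_{-\infty}^\infty F\,d_{12}g=F(\xi,\eta)\,[g(-\infty,-\infty)+g(\infty,\infty)-g(-\infty,\infty)-g(\infty,-\infty)].$$ (b) Let $f\in\mathcal A_c(\mathbb R^2)$ and let $F\in\mathcal B_c(\overline{\mathbb R}^2)$ be its primitive. Suppose $g(x,y)$ vanishes whenever $x$ or $y$ is $\infty$. Then there is $(\xi,\eta)\in\overline{\mathbb R}^2$ such that $$\int_{-\infty}^\infty\int_{-\infty}^\infty fg=F(\xi,\eta)\,[g(-\infty,-\infty)+g(\infty,\infty)-g(-\infty,\infty)-g(\infty,-\infty)].$$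
   Context: $\overline{\mathbb R}=[-\infty,\infty]$ is the two-point compactification of $\mathbb R$, $\overline{\mathbb R}^2$ carries the product topology, and $C(\overline{\mathbb R}^2)$ is the set of continuous real-valued functions on it. $\mathcal B_c(\overline{\mathbb R}^2)=\{F\in C(\overline{\mathbb R}^2)\mid F(-\infty,s)=F(s,-\infty)=0\ \forall s\in\overline{\mathbb R}\}$. $\partial_{12}=\partial_1\partial_2$ is the distributional derivative on $\mathbb R^2$, and $\mathcal A_c(\mathbb R^2)=\{\partial_{12}F\mid F\in\mathcal B_c(\overline{\mathbb R}^2)\}\subset\mathcal D'(\mathbb R^2)$; the primitive $F$ of $f=\partial_{12}F$ is unique. Hardy--Krause variation: a division of $\overline{\mathbb R}^2$ is a finite collection of closed intervals with union $\overline{\mathbb R}^2$ whose pairwise intersections have planar Lebesgue measure zero. For $g:\overline{\mathbb R}^2\to\mathbb R$, $V_{12}g=\sup\sum_i|g(a_i,c_i)+g(b_i,d_i)-g(a_i,d_i)-g(b_i,c_i)|$ over all divisions $\{[a_i,b_i]\times[c_i,d_i]\}$ of $\overline{\mathbb R}^2$; $V_1g(\cdot,y_0)$ and $V_2g(x_0,\cdot)$ are the one-variable total variations over $\overline{\mathbb R}$ of $x\mapsto g(x,y_0)$ and $y\mapsto g(x_0,y)$. $\mathcal{HKBV}(\overline{\mathbb R}^2)$ is the set of $g$ with $V_{12}g<\infty$ and, for some $x_0,y_0\in\overline{\mathbb R}$, $V_1g(\cdot,y_0)<\infty$ and $V_2g(x_0,\cdot)<\infty$. Stieltjes integrals are Henstock--Stieltjes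 integrals: a gauge $\gamma$ assigns to each point an open set containing it (contained in $\mathbb R^2$ for points of $\mathbb R^2$); a tagged division $\{[a_i,b_i]\times[c_i,d_i],(x_i,y_i)\}$ (tag in its interval) is $\gamma$-fine if each interval is contained in $\gamma$ of its tag; $\iint F\,d_{12}g=A$ means for every $\epsilon>0$ there is a gauge $\gamma$ such that $|\sum_iF(x_i,y_i)[g(a_i,c_i)+g(b_i,d_i)-g(a_i,d_i)-g(b_i,c_i)]-A|<\epsilon$ for each $\gamma$-fine tagged division of the interval of integration. $d_1$ and $d_2$ denote the analogous one-variable integrals with respect to the first, resp. second, variable. The integral of the product $fg$ is defined by integration by parts: for $f\in\mathcal A_c(\mathbb R^2)$ with primitive $F$ and $g\in\mathcal{HKBV}(\overline{\mathbb R}^2)$, $\int_{-\infty}^\infty\int_{-\infty}^\infty fg:=F(\infty,\infty)g(\infty,\infty)-\int_{-\infty}^\infty F(s,\infty)\,d_1g(s,\infty)-\int_{-\infty}^\infty F(\infty,t)\,d_2g(\infty,t)+\int_{-\infty}^\infty\int_{-\infty}^\infty F\,d_{12}g$. *)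

(* Defs.v *)
From HB Require Import structures.
From mathcomp Require Import all_boot all_order all_algebra.
From mathcomp Require Import all_classical all_reals all_analysis.

Set Implicit Arguments.
Unset Strict Implicit.
Unset Printing Implicit Defensive.

Import Order.TTheory GRing.Theory Num.Theory.
Import numFieldNormedType.Exports.

Local Open Scope classical_set_scope.
Local Open Scope ring_scope.

(** * Divisions and variations on the extended line and the extended plane *)

Section divisions.
Context {R : realType}.

(* A pair (a, b) : interval1 stands for the closed interval [a, b] of the
   extended line, and (p, q) : interval2 for the product of the closed intervals
   p and q. The condition a <= b is required in division1 and division2. *)
Definition interval1 : Type := (\bar R * \bar R)%type.
Definition interval2 : Type := (interval1 * interval1)%type.

Definition proper1 (p : interval1) : Prop := (p.1 <= p.2)%E.
Definition proper2 (J : interval2) : Prop := proper1 J.1 /\ proper1 J.2.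

Definition set_of1 (p : interval1) : set (\bar R) := `[p.1, p.2].
Definition set_of2 (J : interval2) : set (\bar R * \bar R) :=
  set_of1 J.1 `*` set_of1 J.2.

(* The points at infinity carry no Lebesgue measure. *)
Definition real_part1 (A : set (\bar R)) : set R := [set x | A x%:E].
Definition real_part2 (A : set (\bar R * \bar R)) : set (R * R) :=
  [set z | A (z.1%:E, z.2%:E)].

Definition null1 (A : set (\bar R)) : Prop :=
  (@lebesgue_measure R (real_part1 A) = 0)%E.
Definition null2 (A : set (\bar R * \bar R)) : Prop :=
  ((@lebesgue_measure R \x @lebesgue_measure R) (real_part2 A) = 0)%E.

Definition division1 n (J : 'I_n -> interval1) : Prop :=
  [/\ forall i, proper1 (J i),
      \bigcup_i set_of1 (J i) = setT
    & forall i j, i != j -> null1 (set_of1 (J i) `&` set_of1 (J j))].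

Definition division2 n (J : 'I_n -> interval2) : Prop :=
  [/\ forall i, proper2 (J i),
      \bigcup_i set_of2 (J i) = setT
    & forall i j, i != j -> null2 (set_of2 (J i) `&` set_of2 (J j))].

Definition increment1 (h : \bar R -> R) (p : interval1) : R := h p.2 - h p.1.

Definition increment2 (g : \bar R * \bar R -> R) (J : interval2) : R :=
  let: ((a, b), (c, d)) := J in g (a, c) + g (b, d) - g (a, d) - g (b, c).

Definition variation1 (h : \bar R -> R) : \bar R :=
  ereal_sup [set s | exists n (J : 'I_n -> interval1),
    division1 J /\ s = (\sum_(i < n) `|increment1 h (J i)|)%:E].

Definition variation12 (g : \bar R * \bar R -> R) : \bar R :=
  ereal_sup [set s | exists n (J : 'I_n -> interval2),
    division2 J /\ s = (\sum_(i < n) `|increment2 g (J i)|)%:E].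

Definition HKBV (g : \bar R * \bar R -> R) : Prop :=
  (variation12 g < +oo)%E /\
  exists x0 y0 : \bar R, (variation1 (fun x => g (x, y0)) < +oo)%E /\
                         (variation1 (fun y => g (x0, y)) < +oo)%E.

(** * Henstock-Stieltjes integrals *)

Definition gauge1 (gamma : \bar R -> set (\bar R)) : Prop :=
  [/\ forall t, open (gamma t), forall t, gamma t t
    & forall x : R, gamma x%:E `<=` range EFin].

Definition gauge2 (gamma : \bar R * \bar R -> set (\bar R * \bar R)) : Prop :=
  [/\ forall t, open (gamma t), forall t, gamma t t
    & forall x y : R, gamma (x%:E, y%:E) `<=` range EFin `*` range EFin].

Definition fine_division1 (gamma : \bar R -> set (\bar R)) n
    (J : 'I_n -> interval1) (t : 'I_n -> \bar R) : Prop :=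
  [/\ division1 J, forall i, set_of1 (J i) (t i)
    & forall i, set_of1 (J i) `<=` gamma (t i)].

Definition fine_division2 (gamma : \bar R * \bar R -> set (\bar R * \bar R)) n
    (J : 'I_n -> interval2) (t : 'I_n -> \bar R * \bar R) : Prop :=
  [/\ division2 J, forall i, set_of2 (J i) (t i)
    & forall i, set_of2 (J i) `<=` gamma (t i)].

(* The integral of h with respect to k over the extended line exists and is A. *)
Definition is_stieltjes1 (h k : \bar R -> R) (A : R) : Prop :=
  forall e : R, 0 < e -> exists2 gamma, gauge1 gamma &
    forall n (J : 'I_n -> interval1) (t : 'I_n -> \bar R),
      fine_division1 gamma J t ->
      `|\sum_(i < n) h (t i) * increment1 k (J i) - A| < e.

Definition is_stieltjes2 (F g : \bar R * \bar R -> R) (A : R) : Prop :=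
  forall e : R, 0 < e -> exists2 gamma, gauge2 gamma &
    forall n (J : 'I_n -> interval2) (t : 'I_n -> \bar R * \bar R),
      fine_division2 gamma J t ->
      `|\sum_(i < n) F (t i) * increment2 g (J i) - A| < e.

End divisions.

(** * Distributions on the plane *)

Section distributions.
Context {R : realType}.

Definition e1 : R * R := (1, 0).
Definition e2 : R * R := (0, 1).
Definition dir (b : bool) : R * R := if b then e2 else e1.

(* For w = [:: b1; ...; bk] this is the iterated partial derivative
   d_b1 (... (d_bk phi)), where [false] is the first variable and [true] the
   second. *)
Definition iter_partial (w : seq bool) (phi : R * R -> R) : R * R -> R :=
  foldr (fun b psi => 'D_(dir b) psi) phi w.

Definition smooth (phi : R * R -> R) : Prop :=
  forall w : seq bool, continuous (iter_partial w phi) /\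
    forall (b : bool) (z : R * R), derivable (iter_partial w phi) z (dir b).

Definition supp (phi : R * R -> R) : set (R * R) :=
  closure [set z | phi z != 0].

Definition test_function (phi : R * R -> R) : Prop :=
  smooth phi /\ compact (supp phi).

Definition test_cvg (u : nat -> R * R -> R) (phi : R * R -> R) : Prop :=
  (exists2 K : set (R * R), compact K & forall n, supp (u n) `<=` K) /\
  forall (w : seq bool) (e : R), 0 < e ->
    \forall n \near \oo, forall z,
      `|iter_partial w (u n) z - iter_partial w phi z| < e.

(* A functional is defined on all functions, but only its values on test
   functions are meaningful, see [distribution] and [eq_distr]. *)
Definition functional : Type := (R * R -> R) -> R.

(* A linear functional on the space of test functions is continuous for its
   inductive limit topology if and only if it is sequentially continuous. *)
Definition distribution (T : functional) : Prop :=
  (forall (a : R) (phi psi : R * R -> R),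
     test_function phi -> test_function psi ->
     T (fun z => a * phi z + psi z) = a * T phi + T psi) /\
  (forall (u : nat -> R * R -> R) (phi : R * R -> R),
     (forall n, test_function (u n)) -> test_function phi -> test_cvg u phi ->
     T (u n) @[n --> \oo] --> T phi).

Definition eq_distr (S T : functional) : Prop :=
  forall phi, test_function phi -> S phi = T phi.

Definition partial_distr (b : bool) (T : functional) : functional :=
  fun phi => - T ('D_(dir b) phi).

(* The regular distribution given by the restriction of F to the finite plane. *)
Definition regular_distr (F : \bar R * \bar R -> R) : functional :=
  fun phi => \int[(@lebesgue_measure R \x @lebesgue_measure R)%E]_z
               (F (z.1%:E, z.2%:E) * phi z).

Definition partial12 (F : \bar R * \bar R -> R) : functional :=
  partial_distr false (partial_distr true (regular_distr F)).

Definition Bc (F : \bar R * \bar R -> R) : Prop :=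
  continuous F /\ forall s : \bar R, F (-oo%E, s) = 0 /\ F (s, -oo%E) = 0.

Definition primitive (f : functional) (F : \bar R * \bar R -> R) : Prop :=
  Bc F /\ eq_distr f (partial12 F).

Definition Ac (f : functional) : Prop :=
  distribution f /\ exists F, primitive f F.

(* The integral of f g exists and is v. The primitive of f is unique, so the
   choice of F does not matter. *)
Definition is_integral_prod (f : functional) (g : \bar R * \bar R -> R) (v : R)
    : Prop :=
  exists2 F, primitive f F & exists I1 I2 I12 : R,
    [/\ is_stieltjes1 (fun s => F (s, +oo%E)) (fun s => g (s, +oo%E)) I1,
        is_stieltjes1 (fun t => F (+oo%E, t)) (fun t => g (+oo%E, t)) I2,
        is_stieltjes2 F g I12
      & v = F (+oo%E, +oo%E) * g (+oo%E, +oo%E) - I1 - I2 + I12].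

End distributions.

(* Main.v *)
Require Import Defs.
From mathcomp Require Import all_boot all_order all_algebra.
From mathcomp Require Import all_classical all_reals all_analysis.
From mathcomp Require Import measurable_realfun ring lra.
Import Order.TTheory GRing.Theory Num.Theory.
Import numFieldNormedType.Exports.
Local Open Scope classical_set_scope.
Local Open Scope ring_scope.

(** Since all increments of [g] are nonnegative, the integral can be built the
    way Darboux builds a Riemann integral: a lower sum is a sum of
    [c i * increment2 g (J i)] where [c i] bounds [F] below on the rectangle
    [J i] of a division, an upper sum is defined symmetrically, and the integral
    is the supremum [A] of all lower sums.

    The point is that every lower sum is at most every upper sum, for any two
    divisions [J] and [K] ([lower_sum_le_upper_sum]): both sums split over the
    rectangles [J i `&` K j], on which the two constants are compared at a common
    point. The splitting rests on the additivity of increments over an arbitrary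
    division ([division2_increment]), which holds for every function, by passing
    to the grid spanned by the endpoints of the division.

    The division of the plane into a single rectangle then gives
    [l * W <= A <= u * W], where [l] and [u] bound [F] and [W] is the increment
    of [g] over the plane. If the gauge at [t] only allows points where [F]
    differs from [F t] by less than [d], then the Riemann sum of a fine division
    shifted by [- d * W] is a lower sum and shifted by [d * W] an upper sum, so
    it lies within [d * W] of [A] ([stieltjes2_exists]).

    Finally [expand] maps the real plane continuously onto the extended plane, so
    [F] attains its bounds and every value between them; hence [A / W] is a value
    of [F] when [W > 0], and [A = 0] when [W = 0].

    In (b) the two one-variable integrals have constant integrator [0] and the
    boundary product vanishes, so the integral of [f g] reduces to the one in
    (a). *)

(** * Continuous functions on the extended plane *)

(** The distance on the extended line is that of the images under [contract], so
    this says that clamping a real number to the interval from -1 to 1, which is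
    [contract \o expand], is 1-Lipschitz. *)
Lemma continuous_expand (R : realType) : continuous (@expand R).
Proof.
move=> x; apply/cvg_ballP => e e0; near=> y.
rewrite /ball /= /ereal_ball.
have clampE (t : R) : contract (expand t) = Num.max (-1) (Num.min 1 t).
  have [t1|t1] := lerP 1 t.
    by rewrite expand1//= max_r//; lra.
  have [tN1|tN1] := lerP t (-1).
    by rewrite expandN1//= max_l.
  by rewrite expandK ?max_r// ?inE ?ler_norml; lra.
rewrite !clampE.
have : `|x - y| < e by near: y; exact: cvgr_dist_lt.
rewrite !ltr_norml => /andP[h1 h2].
by rewrite /Num.max /Num.min; do !case: ifP; lra.
Unshelve. all: by end_near. Qed.

Section extrema.
Context {R : realType} (F : \bar R * \bar R -> R) (cF : continuous F).

Let G (z : R * R) : R := F (expand z.1, expand z.2).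

Let cG : continuous G.
Proof.
move=> z; apply: (@continuous_comp _ _ _
  (fun z : R * R => (expand z.1, expand z.2)) F); last exact: cF.
apply: cvg_pair.
  apply: (@continuous_comp _ _ _ fst (@expand R)); first exact: cvg_fst.
  exact: continuous_expand.
apply: (@continuous_comp _ _ _ snd (@expand R)); first exact: cvg_snd.
exact: continuous_expand.
Qed.

Let square : set (R * R) := `[-1, 1] `*` `[-1, 1].

Let contract_square z : (contract z.1, contract z.2) \in square.
Proof.
rewrite inE; split => /=; rewrite in_itv/= -ler_norml; exact: contract_le1.
Qed.

Lemma continuous_ereal2_EVT :
  exists zmin zmax, forall z, F zmin <= F z <= F zmax.
Proof.
have sq0 : square !=set0 by exists 0; split; rewrite /= in_itv/=; lra.
have cS : compact square by apply: compact_setX; exact: segment_compact.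
have cGS : {within square, continuous G} by exact: continuous_subspaceT.
have [u _ minu] := compact_EVT_min sq0 cS cGS.
have [v _ maxv] := compact_EVT_max sq0 cS cGS.
exists (expand u.1, expand u.2), (expand v.1, expand v.2) => z.
have := minu _ (contract_square z); have := maxv _ (contract_square z).
by rewrite /G /= !contractK -surjective_pairing => -> ->.
Qed.

(** The image under [expand] of the segment joining [contract z1] to [contract z2]
    is a path from [z1] to [z2] in the extended plane. *)
Lemma continuous_ereal2_IVT (z1 z2 : \bar R * \bar R) (v : R) :
  F z1 <= v <= F z2 -> exists z, F z = v.
Proof.
move=> /andP[h1 h2].
pose seg (t : R) : R * R := ((1 - t) * contract z1.1 + t * contract z2.1,
  (1 - t) * contract z1.2 + t * contract z2.2).
have cseg : continuous (G \o seg).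
  move=> t; apply: continuous_comp; last exact: cG.
  have c2 (a b : R) : (1 - s) * a + s * b @[s --> t] --> (1 - t) * a + t * b.
    apply: cvgD; apply: cvgM; [|exact: cvg_cst|exact: cvg_id|exact: cvg_cst].
    by apply: cvgB; [exact: cvg_cst|exact: cvg_id].
  exact: (cvg_pair (c2 _ _) (c2 _ _)).
have G0 : (G \o seg) 0 = F z1.
  by rewrite /G/= !mul0r !addr0 subr0 !mul1r !contractK -surjective_pairing.
have G1 : (G \o seg) 1 = F z2.
  by rewrite /G/= subrr !mul0r !add0r !mul1r !contractK -surjective_pairing.
have [|t _ <-] := @IVT R (G \o seg) 0 1 v ler01 (continuous_subspaceT cseg).
  by rewrite G0 G1 ge_min h1 le_max h2 orbT.
by exists (expand (seg t).1, expand (seg t).2).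
Qed.
End extrema.

(** * Overlapping rectangles are not null *)

Section measure_of_intervals.
Context {R : realType}.
Implicit Types p q : \bar R.

(** Between distinct points of the extended line there is a real segment of
    positive length: points at infinity cannot make a nondegenerate interval null. *)
Lemma ereal_lt_two_reals p q : (p < q)%E ->
  exists u v : R, [/\ u < v, (p < u%:E)%E & (v%:E < q)%E].
Proof.
case: p => [r| |]; case: q => [s| |]//= pq.
- exists ((2 * r + s) / 3), ((r + 2 * s) / 3).
  by move: pq; rewrite !lte_fin => pq; split; lra.
- by exists (r + 1), (r + 2); rewrite ltry lte_fin; split => //; lra.
- by exists (s - 2), (s - 1); rewrite ltNyr lte_fin; split => //; lra.
- by exists 0, 1; rewrite ltry ltNyr.
Qed.

Lemma measurable_real_part1 (I : interval1) :
  measurable (real_part1 (set_of1 I) : set R).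
Proof.
rewrite -[X in measurable X]setTI.
by apply: EFin_measurable => //; exact: emeasurable_itv.
Qed.

Lemma overlap1_measure_neq0 (I K : interval1) p q : (p < q)%E ->
  `[p, q] `<=` set_of1 I -> `[p, q] `<=` set_of1 K ->
  (@lebesgue_measure R (real_part1 (set_of1 I) `&` real_part1 (set_of1 K)) != 0)%E.
Proof.
move=> /ereal_lt_two_reals[u [v [uv pu vq]]] sI sK.
rewrite gt_eqF//; apply: (@lt_le_trans _ _ (@lebesgue_measure R `[u, v])).
  by rewrite lebesgue_measure_itv/= lte_fin uv -EFinB lte_fin subr_gt0.
apply: le_measure; rewrite ?inE.
- exact: measurable_itv.
- by apply: measurableI; exact: measurable_real_part1.
move=> x /=; rewrite in_itv/= => /andP[ux xv].
have xpq : `[p, q]%classic x%:E.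
  rewrite /= in_itv/= (le_trans (ltW pu)) ?lee_fin//=.
  by rewrite (le_trans _ (ltW vq))// lee_fin.
by split; [exact: sI|exact: sK].
Qed.

(** The real part of the overlap is a product of two sets, each of which contains a
    segment of positive length. *)
Lemma overlap2_not_null (J K : interval2) p q r s : (p < q)%E -> (r < s)%E ->
  `[p, q] `*` `[r, s] `<=` set_of2 J `&` set_of2 K ->
  ~ null2 (set_of2 J `&` set_of2 K).
Proof.
move=> pq rs sJK; rewrite /null2.
have -> : real_part2 (set_of2 J `&` set_of2 K) =
    (real_part1 (set_of1 J.1) `&` real_part1 (set_of1 K.1)) `*`
    (real_part1 (set_of1 J.2) `&` real_part1 (set_of1 K.2)).
  by apply/seteqP; split=> z /= [[? ?] [? ?]].
rewrite product_measure1E; try by apply: measurableI; exact: measurable_real_part1.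
apply/eqP; rewrite mule_eq0 negb_or.
have pin : `[p, q]%classic p by rewrite /= in_itv/= lexx ltW.
have rin : `[r, s]%classic r by rewrite /= in_itv/= lexx ltW.
rewrite (@overlap1_measure_neq0 _ _ p q)//.
- rewrite (@overlap1_measure_neq0 _ _ r s)// => y ry.
  + by have [] := sJK (p, y) (conj pin ry) => -[].
  + by have [] := sJK (p, y) (conj pin ry) => _ [].
- by move=> x px; have [] := sJK (x, r) (conj px rin) => -[].
- by move=> x px; have [] := sJK (x, r) (conj px rin) => _ [].
Qed.
End measure_of_intervals.

(** * Increments are additive over a division *)

Section grid.
Context {R : realType}.

Definition grid (X : nat -> \bar R) (N : nat) : Prop :=
  [/\ X 0%N = -oo%E, X N = +oo%E &
      forall i j, (i <= N)%N -> (j <= N)%N -> (X i <= X j)%E = (i <= j)%N].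

Definition on_grid (X : nat -> \bar R) (N : nat) (x : \bar R) : Prop :=
  exists2 i, (i <= N)%N & X i = x.

Lemma grid_through (s : seq (\bar R)) :
  exists X N, grid X N /\ forall x, x \in s -> on_grid X N x.
Proof.
pose t := sort <=%O%O (undup [:: -oo%E, +oo%E & s]).
have st : sorted <%O%O t by rewrite sort_lt_sorted undup_uniq.
have mt x : (x \in t) = (x \in [:: -oo%E, +oo%E & s]).
  by rewrite mem_sort mem_undup.
have t0 : (0 < size t)%N.
  by rewrite (leq_ltn_trans (leq0n (index -oo%E t)))// index_mem mt mem_head.
have szt i : (i <= (size t).-1)%N = (i < size t)%N by rewrite -ltnS prednK.
have onX x : x \in [:: -oo%E, +oo%E & s] -> on_grid (nth -oo%E t) (size t).-1 x.
  rewrite -mt => xt; exists (index x t); last by rewrite nth_index.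
  by rewrite szt index_mem.
have mono i j : (i <= (size t).-1)%N -> (j <= (size t).-1)%N ->
    (nth -oo%E t i <= nth -oo%E t j)%E = (i <= j)%N.
  by rewrite !szt => it jt; exact: (lt_sorted_leq_nth _ st).
exists (nth -oo%E t), (size t).-1; split; last first.
  by move=> x xs; apply: onX; rewrite !inE xs !orbT.
split => //.
- have [|i iN Xi] := onX -oo%E; first by rewrite !inE eqxx.
  by apply/eqP; rewrite -leeNy_eq -[leRHS]Xi mono.
- have [|i iN Xi] := onX +oo%E; first by rewrite !inE eqxx orbT.
  by apply/eqP; rewrite -leye_eq -[leLHS]Xi mono.
Qed.

(** The condition [a <= X k < b] selects the cells between [a] and [b], so this is
    a telescoping sum, written over all cells so that sums for different intervals
    can be exchanged. *)
Lemma increment_grid1 X N (h : \bar R -> R) a b : grid X N ->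
  on_grid X N a -> on_grid X N b -> (a <= b)%E ->
  h b - h a =
  \sum_(k < N) (a <= X k < b)%E%:R * (h (X k.+1) - h (X k)).
Proof.
move=> [_ _ mono] [i iN <-{a}] [j jN <-{b}]; rewrite mono// => ij.
rewrite -(telescope_sumr (h \o X) ij)/=.
rewrite (big_nat_widen _ _ _ _ _ jN) (big_nat_widenl _ 0)// big_mkord big_mkcond/=.
apply: eq_bigr => k _; have kN := ltnW (ltn_ord k).
rewrite mono// ltNge mono// -ltnNge andbC.
by case: ifP => _; rewrite ?mul1r ?mul0r.
Qed.

Lemma increment_grid2 X N Y M (h : \bar R * \bar R -> R) a b c d :
  grid X N -> grid Y M ->
  on_grid X N a -> on_grid X N b -> (a <= b)%E ->
  on_grid Y M c -> on_grid Y M d -> (c <= d)%E ->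
  increment2 h ((a, b), (c, d)) =
  \sum_(k < N) \sum_(l < M) ((a <= X k < b) && (c <= Y l < d))%E%:R *
     increment2 h ((X k, X k.+1), (Y l, Y l.+1)).
Proof.
move=> gX gY aX bX ab cY dY cd.
transitivity ((h (b, d) - h (b, c)) - (h (a, d) - h (a, c))).
  by rewrite /=; ring.
rewrite (increment_grid1 _ _ (fun x => h (x, d) - h (x, c)) _ _ gX aX bX ab).
apply: eq_bigr => k _.
have E x := increment_grid1 _ _ (fun y => h (x, y)) _ _ gY cY dY cd.
rewrite !E -sumrB mulr_sumr; apply: eq_bigr => l _.
by case: (a <= X k < b)%E => /=; rewrite ?mul0r// mul1r -mulrBr /=; congr (_ * _); ring.
Qed.

Lemma sum_indicator_unique n (P : pred 'I_n) j0 : P j0 ->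
  (forall j, P j -> j = j0) -> \sum_(j < n) (P j)%:R = 1 :> R.
Proof.
move=> Pj0 uP; rewrite (bigD1 j0)//= Pj0 big1 ?addr0// => j jj0.
by case: (boolP (P j)) => // /uP jE; rewrite jE eqxx in jj0.
Qed.

Lemma gridS_lt X N k : grid X N -> (k < N)%N -> (X k < X k.+1)%E.
Proof. by move=> [_ _ mono] kN; rewrite ltNge mono// -?ltnNge// ltnW. Qed.

(** No grid point lies strictly between [X k] and [X k.+1]; therefore an interval
    with endpoints on the grid that meets the interior of a cell contains it. *)
Lemma grid_ltS X N k x : grid X N -> (k < N)%N -> on_grid X N x ->
  (X k < x)%E = (X k.+1 <= x)%E.
Proof.
move=> [_ _ mono] kN [i iN <-]; rewrite ltNge !mono// -?ltnNge//.
exact: ltnW.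
Qed.

(** Refine the rectangles by the grid of all their endpoints. Each cell contains
    an interior real point, so some rectangle of the division covers it and,
    having its endpoints on the grid, contains the whole cell. A second rectangle
    containing the cell would overlap the first in positive measure. Hence every
    cell increment is counted exactly once. Flat rectangles, which may overlap
    freely at infinity, contain no cell. *)
Lemma division2_increment n (K : 'I_n -> interval2) (h : \bar R * \bar R -> R) :
  division2 K ->
  \sum_(j < n) increment2 h (K j) = increment2 h ((-oo, +oo), (-oo, +oo))%E.
Proof.
move=> [pK cK dK].
have [X [N [gX XK]]] := grid_through
  ([seq (K j).1.1 | j : 'I_n] ++ [seq (K j).1.2 | j : 'I_n]).
have [Y [M [gY YK]]] := grid_through
  ([seq (K j).2.1 | j : 'I_n] ++ [seq (K j).2.2 | j : 'I_n]).
have XK1 j : on_grid X N (K j).1.1.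
  by apply: XK; rewrite mem_cat (codom_f (fun i => (K i).1.1)).
have XK2 j : on_grid X N (K j).1.2.
  by apply: XK; rewrite mem_cat orbC (codom_f (fun i => (K i).1.2)).
have YK1 j : on_grid Y M (K j).2.1.
  by apply: YK; rewrite mem_cat (codom_f (fun i => (K i).2.1)).
have YK2 j : on_grid Y M (K j).2.2.
  by apply: YK; rewrite mem_cat orbC (codom_f (fun i => (K i).2.2)).
pose inK j k l := (((K j).1.1 <= X k < (K j).1.2) &&
                   ((K j).2.1 <= Y l < (K j).2.2))%E.
have incK j : increment2 h (K j) = \sum_(k < N) \sum_(l < M) (inK j k l)%:R *
    increment2 h ((X k, X k.+1), (Y l, Y l.+1)).
  have [p1 p2] := pK j.
  rewrite [K j in LHS]surjective_pairing [(K j).1]surjective_pairing.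
  rewrite [(K j).2]surjective_pairing.
  exact: increment_grid2.
have gX0 : on_grid X N -oo%E by case: gX => X0 _ _; exists 0%N.
have gXN : on_grid X N +oo%E by case: gX => _ XN _; exists N.
have gY0 : on_grid Y M -oo%E by case: gY => Y0 _ _; exists 0%N.
have gYM : on_grid Y M +oo%E by case: gY => _ YM _; exists M.
rewrite (@increment_grid2 X N Y M)//.
under eq_bigr do rewrite incK.
rewrite exchange_big/=; apply: eq_bigr => k _.
rewrite exchange_big/=; apply: eq_bigr => l _.
rewrite -mulr_suml; congr (_ * _).
have kS := gridS_lt _ _ _ gX (ltn_ord k); have lS := gridS_lt _ _ _ gY (ltn_ord l).
rewrite !leNye (lt_le_trans kS (leey _)) (lt_le_trans lS (leey _))/=.
have inKP j : inK j k l -> `[X k, X k.+1] `*` `[Y l, Y l.+1] `<=` set_of2 (K j).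
  move=> /andP[/andP[aX]]; rewrite (grid_ltS _ _ _ _ gX)// => Xb.
  move=> /andP[cY]; rewrite (grid_ltS _ _ _ _ gY)// => Yd.
  move=> -[x y] [] /=; rewrite !in_itv/= => /andP[xX Xx] /andP[yY Yy].
  split; rewrite /set_of1 /= in_itv /=.
    by rewrite (le_trans aX)//= (le_trans Xx).
  by rewrite (le_trans cY)//= (le_trans Yy).
(* [(x, y)] is a real point in the interior of the cell *)
have [x [x' [xx' Xx x'X]]] := ereal_lt_two_reals _ _ kS.
have [y [y' [yy' Yy y'Y]]] := ereal_lt_two_reals _ _ lS.
have [j0 _ [xj yj]] : (\bigcup_j set_of2 (K j)) (x%:E, y%:E) by rewrite cK.
have xXS : (x%:E < X k.+1)%E by rewrite (lt_trans _ x'X)// lte_fin.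
have yYS : (y%:E < Y l.+1)%E by rewrite (lt_trans _ y'Y)// lte_fin.
have j0K : inK j0 k l.
  move: xj yj; rewrite /set_of1 /= !in_itv/= => /andP[ax xb] /andP[cy yd].
  apply/andP; split; apply/andP; split.
  - by rewrite leNgt (grid_ltS _ _ _ _ gX)// -ltNge (le_lt_trans ax).
  - exact: lt_le_trans Xx xb.
  - by rewrite leNgt (grid_ltS _ _ _ _ gY)// -ltNge (le_lt_trans cy).
  - exact: lt_le_trans Yy yd.
apply: (@sum_indicator_unique _ _ j0) => // j jK; apply: contrapT => /eqP jj0.
apply: (@overlap2_not_null R (K j) (K j0) _ _ _ _ kS lS); last exact: dK.
by move=> z zc; split; [exact: inKP zc|exact: inKP zc].
Qed.
End grid.

(** * Splitting an increment over a division *)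

Section cap.
Context {R : realType}.

Definition clamp (I : @interval1 R) (x : \bar R) : \bar R :=
  Order.max I.1 (Order.min x I.2).

(** The intersection of [I] and [K] when they meet, and otherwise a flat interval
    at an endpoint of [I]. Unlike the intersection, it is always an interval, and
    it depends on [K] only through the map [clamp I] applied to its endpoints. *)
Definition cap1 (I K : @interval1 R) : interval1 := (clamp I K.1, clamp I K.2).

Definition cap2 (I K : @interval2 R) : interval2 := (cap1 I.1 K.1, cap1 I.2 K.2).

Lemma cap1_proper I K : proper1 K -> proper1 (cap1 I K).
Proof.
rewrite /proper1 /= => K12; rewrite /clamp.
have minK : (Order.min K.1 I.2 <= Order.min K.2 I.2)%E.
  by rewrite le_min !ge_min K12 lexx orbT.
by rewrite ge_max !le_max lexx minK orbT.
Qed.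

Lemma cap1P I K : proper1 I -> proper1 K ->
  (cap1 I K = cap1 K I /\ exists x, set_of1 I x /\ set_of1 K x) \/
  ((cap1 I K).1 = (cap1 I K).2 /\ (cap1 K I).1 = (cap1 K I).2).
Proof.
case: I K => [a b] [c d]; rewrite /proper1/= => ab cd.
have [cb|bc] := leP c b; last first.
  right; rewrite /clamp/= (min_r (ltW bc)) (min_r (le_trans (ltW bc) cd)).
  rewrite (min_l (le_trans ab (le_trans (ltW bc) cd))).
  by rewrite (min_l (le_trans (ltW bc) cd)) !(max_l (le_trans _ (ltW bc))).
have [ad|da] := leP a d; last first.
  right; rewrite /clamp/= (min_l cb) (min_l (le_trans (ltW da) ab)).
  rewrite (max_l (le_trans cd (ltW da))) (max_l (ltW da)).
  by rewrite (min_r (ltW da)) (min_r (le_trans (ltW da) ab)).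
left; rewrite /cap1 /clamp/= (min_l cb) (min_l ad); split.
  rewrite (maxC a c) (minC d b); congr pair.
  by rewrite !max_r// le_min ?cb ?cd ?ab ?ad.
exists (Order.max a c); rewrite /set_of1/= !in_itv/= !ge_max !le_max !lexx ab cb ad cd.
by rewrite orbT.
Qed.

Lemma increment2_flat1 (g : \bar R * \bar R -> R) (J : interval2) :
  J.1.1 = J.1.2 -> increment2 g J = 0.
Proof. by case: J => [[a b] [c d]] /= ->; ring. Qed.

Lemma increment2_flat2 (g : \bar R * \bar R -> R) (J : interval2) :
  J.2.1 = J.2.2 -> increment2 g J = 0.
Proof. by case: J => [[a b] [c d]] /= ->; ring. Qed.

(** [cap2] is not symmetric when the rectangles are disjoint, but then both
    variants are flat in the same coordinate and have increment 0. *)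
Lemma increment2_cap2P (g : \bar R * \bar R -> R) J K : proper2 J -> proper2 K ->
  increment2 g (cap2 J K) = increment2 g (cap2 K J) /\
  (increment2 g (cap2 J K) = 0 \/ exists z, set_of2 J z /\ set_of2 K z).
Proof.
move=> [J1 J2] [K1 K2].
have [[E1 [x [Jx Kx]]]|[F1 G1]] := cap1P _ _ J1 K1; last first.
  rewrite (increment2_flat1 _ (cap2 J K))// (increment2_flat1 _ (cap2 K J))//.
  by split => //; left.
have [[E2 [y [Jy Ky]]]|[F2 G2]] := cap1P _ _ J2 K2; last first.
  rewrite (increment2_flat2 _ (cap2 J K))// (increment2_flat2 _ (cap2 K J))//.
  by split => //; left.
split; first by rewrite /cap2 E1 E2.
by right; exists (x, y).
Qed.

(** The increments of [g] over the [cap2 J (K j)] are those over the [K j] of [g]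
    composed with the clamping to [J], a function on the whole plane to which
    additivity over the division [K] applies. *)
Lemma increment2_split n (K : 'I_n -> interval2) (g : \bar R * \bar R -> R) J :
  division2 K -> proper2 J ->
  increment2 g J = \sum_(j < n) increment2 g (cap2 J (K j)).
Proof.
move=> dK [J1 J2].
pose gJ z := g (clamp J.1 z.1, clamp J.2 z.2).
have gJE L : increment2 g (cap2 J L) = increment2 gJ L.
  by case: L => [[? ?] [? ?]].
under eq_bigr do rewrite gJE.
rewrite division2_increment// -gJE; congr increment2.
case: J J1 J2 {gJ gJE} => [[a b] [c d]]; rewrite /proper1/= => ab cd.
rewrite /cap2 /cap1 /clamp/=.
by rewrite !(min_l (leNye _)) !(max_l (leNye _)) !(min_r (leey _)) !max_r.
Qed.

(** * Gauges *)

Lemma open_fin_num : open [set x : \bar R | x \is a fin_num].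
Proof.
rewrite (_ : [set x | _] = [set x | -oo < x]%E `&` [set x | x < +oo]%E).
  apply: openI; [exact: open_ereal_gt_ereal|exact: open_ereal_lt_ereal].
by apply/seteqP; split=> x /=; rewrite fin_numElt => /andP.
Qed.

(** An integrator without increments makes every Riemann sum vanish, so the
    coarsest possible gauge serves every tolerance. *)
Lemma stieltjes1_cst (h k : \bar R -> R) :
  (forall x y, k x = k y) -> is_stieltjes1 h k 0.
Proof.
move=> kC e e0.
exists (fun t => if t \is a fin_num then [set x | x \is a fin_num] else setT).
  split=> [t|t|x y].
  - by case: ifP => _; [exact: open_fin_num|exact: openT].
  - by case: ifP.
  - by rewrite /= => yfin; exists (fine y) => //; rewrite fineK.
move=> n J t _; rewrite big1 ?subr0 ?normr0// => i _.
by rewrite /increment1 (kC _ (J i).1) subrr mulr0.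
Qed.

(** By continuity the points where [F] differs from [F t] by less than [d] form an
    open set; intersecting it with the finite plane, also open, when [t] is finite
    makes it a gauge. *)
Lemma gauge2_oscillation (F : \bar R * \bar R -> R) (d : R) :
  continuous F -> 0 < d ->
  exists2 gamma, gauge2 gamma & forall t z, gamma t z -> `|F t - F z| < d.
Proof.
move=> cF d0.
pose finite := [set z : \bar R * \bar R | z.1 \is a fin_num /\ z.2 \is a fin_num].
have ofin : open finite.
  rewrite (_ : finite = (fst @^-1` [set x : \bar R | x \is a fin_num]) `&`
    (snd @^-1` [set x : \bar R | x \is a fin_num]))//.
  apply: openI; (apply: open_comp; last exact: open_fin_num) => z _.
    exact: cvg_fst.
  exact: cvg_snd.
exists (fun t => [set z | `|F t - F z| < d] `&`
  (if `[< finite t >] then finite else setT)); last by move=> t z [].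
split.
- move=> t; apply: openI; last by case: ifP => // _; exact: openT.
  rewrite (_ : [set z | _] = F @^-1` ball (F t) d)//.
  by apply: open_comp; [move=> ? _; exact: cF|exact: ball_open].
- move=> t; split; first by rewrite /= subrr normr0.
  by case: ifPn => // /asboolP.
- move=> x y z [_]; rewrite asboolT//= => -[z1 z2].
  by split; rewrite /=; [exists (fine z.1)|exists (fine z.2)] => //; rewrite fineK.
Qed.

(** * Lower and upper sums *)

Section darboux.
Context (g : \bar R * \bar R -> R).
Context (hpos : forall a b c d : \bar R, (a <= b)%E -> (c <= d)%E ->
  0 <= g (a, c) + g (b, d) - g (a, d) - g (b, c)).
Context (F : \bar R * \bar R -> R).

Lemma increment2_ge0 J : proper2 J -> 0 <= increment2 g J.
Proof. by case: J => [[a b] [c d]] [] /=; exact: hpos. Qed.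

(** Over a common piece [cap2 (J i) (K j)] of nonzero increment, [u i] and [v j]
    are separated by the value of [F] at a point of both rectangles. *)
Lemma lower_sum_le_upper_sum n (J : 'I_n -> interval2) (u : 'I_n -> R)
    m (K : 'I_m -> interval2) (v : 'I_m -> R) :
  division2 J -> (forall i z, set_of2 (J i) z -> u i <= F z) ->
  division2 K -> (forall j z, set_of2 (K j) z -> F z <= v j) ->
  \sum_(i < n) u i * increment2 g (J i) <= \sum_(j < m) v j * increment2 g (K j).
Proof.
move=> dJ uF dK vF; have [pJ _ _] := dJ; have [pK _ _] := dK.
under eq_bigr => i _ do rewrite (increment2_split _ K)// mulr_sumr.
under [leRHS]eq_bigr => j _ do rewrite (increment2_split _ J)// mulr_sumr.
rewrite [leRHS]exchange_big.
apply: ler_sum => i _; apply: ler_sum => j _.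
have [<- [->|[z [Jz Kz]]]] := increment2_cap2P g _ _ (pJ i) (pK j).
  by rewrite !mulr0.
rewrite ler_wpM2r ?(le_trans (uF _ _ Jz))// ?vF//.
by apply: increment2_ge0; have [p1 p2] := pK j; split; exact: cap1_proper.
Qed.

Let whole : @interval2 R := ((-oo, +oo), (-oo, +oo))%E.
Let W := increment2 g whole.

Let whole_div : division2 (fun _ : 'I_1 => whole).
Proof.
split=> [_||i j]; first by split; rewrite /proper1/= leNye.
- apply/seteqP; split => // z _; exists ord0 => //.
  by split; rewrite /set_of1/= in_itv/= leNye leey.
- by rewrite (ord1 i) (ord1 j) eqxx.
Qed.

(** [A] is the supremum of the lower sums; the bounds on it are the lower and the
    upper sum of the division with the single rectangle [whole]. *)
Lemma stieltjes2_exists (l u : R) :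
  continuous F -> (forall z, l <= F z <= u) ->
  exists2 A, l * W <= A <= u * W & is_stieltjes2 F g A.
Proof.
move=> cF luF.
pose lower : set R := [set s | exists n (J : 'I_n -> interval2) (c : 'I_n -> R),
  [/\ division2 J, forall i z, set_of2 (J i) z -> c i <= F z &
      s = \sum_(i < n) c i * increment2 g (J i)]].
have ub n (K : 'I_n -> interval2) (v : 'I_n -> R) : division2 K ->
    (forall j z, set_of2 (K j) z -> F z <= v j) ->
    ubound lower (\sum_(j < n) v j * increment2 g (K j)).
  by move=> dK vF _ [m [J [c [dJ cJ ->]]]]; exact: lower_sum_le_upper_sum.
have lowW : lower (l * W).
  exists 1%N, (fun=> whole), (fun=> l); rewrite big_ord1; split => // _ z _.
  by have /andP[] := luF z.
have ubW : ubound lower (u * W).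
  have := ub _ (fun _ : 'I_1 => whole) (fun=> u) whole_div; rewrite big_ord1.
  by apply=> _ z _; have /andP[] := luF z.
have W0 : 0 <= W by apply: increment2_ge0; split; rewrite /proper1/= leNye.
exists (sup lower).
  rewrite ub_le_sup//; last by exists (u * W).
  by rewrite ge_sup//; exists (l * W).
(* the denominator is [W + 1] because [W] may be 0 *)
move=> e e0; pose d := e / (W + 1).
have d0 : 0 < d by rewrite divr_gt0//; lra.
have [gamma gg oscF] := gauge2_oscillation F d cF d0.
exists gamma => //.
move=> n J t [dJ tJ fJ].
have close i z : set_of2 (J i) z -> F (t i) - d <= F z <= F (t i) + d.
  move=> /fJ/oscF; rewrite ltr_norml => /andP[? ?]; apply/andP; split; lra.
have sumW (c : R) : \sum_(i < n) (F (t i) + c) * increment2 g (J i) =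
    \sum_(i < n) F (t i) * increment2 g (J i) + c * W.
  rewrite /W -(division2_increment _ J)// mulr_sumr -big_split/=.
  by apply: eq_bigr => i _; rewrite mulrDl.
have lo : \sum_(i < n) F (t i) * increment2 g (J i) - d * W <= sup lower.
  rewrite -mulNr -sumW; apply: ub_le_sup; first by exists (u * W).
  by exists n, J, (fun i => F (t i) - d); split => // i z /close/andP[].
have hi : sup lower <= \sum_(i < n) F (t i) * increment2 g (J i) + d * W.
  rewrite -sumW; apply: ge_sup; first by exists (l * W).
  by apply: ub => // i z /close/andP[].
have dW : d * W < e.
  by rewrite /d mulrAC ltr_pdivrMr ?ltr_pM2l//; lra.
by rewrite ltr_norml; apply/andP; split; lra.
Qed.

Lemma stieltjes2_mean_value :
  continuous F -> exists xi eta, is_stieltjes2 F g (F (xi, eta) * W).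
Proof.
move=> cF; have [z1 [z2 F12]] := continuous_ereal2_EVT F cF.
have [A /andP[lA Au] intA] := stieltjes2_exists _ _ cF F12.
suff [[xi eta] zA] : exists z, F z * W = A by exists xi, eta; rewrite zA.
have W0 : 0 <= W by apply: increment2_ge0; split; rewrite /proper1/= leNye.
have [W_eq0|W_neq0] := eqVneq W 0.
  by exists z1; apply/eqP; rewrite eq_le lA W_eq0 mulr0 -(mulr0 (F z2)) -W_eq0.
have Wgt0 : 0 < W by rewrite lt_def W_neq0.
have [|z zA] := continuous_ereal2_IVT F cF z1 z2 (A / W).
  by rewrite ler_pdivlMr// lA ler_pdivrMr.
by exists z; rewrite zA divfK.
Qed.

End darboux.
End cap.

Theorem proposition7p7 (R : realType) (g : \bar R * \bar R -> R)
    (hg : HKBV g)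
    (hpos : forall a b c d : \bar R, (a <= b)%E -> (c <= d)%E ->
       0 <= g (a, c) + g (b, d) - g (a, d) - g (b, c)) :
  (forall F : \bar R * \bar R -> R, continuous F ->
     exists xi eta : \bar R,
       is_stieltjes2 F g
         (F (xi, eta) *
          (g (-oo%E, -oo%E) + g (+oo%E, +oo%E)
           - g (-oo%E, +oo%E) - g (+oo%E, -oo%E)))) /\
  (forall (f : functional) (F : \bar R * \bar R -> R),
     Ac f -> primitive f F ->
     (forall x y : \bar R, x = +oo%E \/ y = +oo%E -> g (x, y) = 0) ->
     exists xi eta : \bar R,
       is_integral_prod f g
         (F (xi, eta) *
          (g (-oo%E, -oo%E) + g (+oo%E, +oo%E)
           - g (-oo%E, +oo%E) - g (+oo%E, -oo%E)))).
Proof.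
have WE : increment2 g ((-oo, +oo), (-oo, +oo))%E =
    g (-oo%E, -oo%E) + g (+oo%E, +oo%E) - g (-oo%E, +oo%E) - g (+oo%E, -oo%E).
  by [].
have mean F : continuous F -> exists xi eta, is_stieltjes2 F g (F (xi, eta) *
    (g (-oo%E, -oo%E) + g (+oo%E, +oo%E) - g (-oo%E, +oo%E) - g (+oo%E, -oo%E))).
  by move=> cF; rewrite -WE; exact: stieltjes2_mean_value.
split=> // f F _ primF g0.
have [xi [eta intF]] := mean F primF.1.1.
exists xi, eta, F => //; exists 0, 0; eexists; split; [| |exact: intF|].
- by apply: stieltjes1_cst => x y; rewrite !g0//; right.
- by apply: stieltjes1_cst => x y; rewrite !g0//; left.
- by rewrite (g0 +oo%E +oo%E (or_introl erefl)) mulr0 !subr0 add0r.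
Qed.
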